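(* Let $\mathcal{D}$ be a domain in $\mathbb{H}$ and let $f:\mathcal{D}\to\mathbb{C}$ be polar-analytic. Suppose that $(r_0,\theta_0)\in\mathcal{D}$ is an accumulation point of distinct zeros of $f$. Then $f$ is identically zero.
   Context: $\mathbb{H}:=\{(r,\theta): r\in\mathbb{R}^+,\ \theta\in\mathbb{R}\}$ with $\mathbb{R}^+=(0,\infty)$, regarded as an open subset of $\mathbb{R}^2$; a domain is a nonempty open connected subset. A function $f:\mathcal{D}\to\mathbb{C}$ on a domain $\mathcal{D}\subset\mathbb{H}$ is polar-analytic if for every $(r_0,\theta_0)\in\mathcal{D}$ the limit $$(D_{\rm pol}f)(r_0,\theta_0):=\lim_{(r,\theta)\to(r_0,\theta_0)}\frac{f(r,\theta)-f(r_0,\theta_0)}{re^{i\theta}-r_0e^{i\theta_0}}$$ exists. No periodicity in $\theta$ is assumed. *)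

(* Defs.v *)
From Stdlib Require Import Reals.
From Coquelicot Require Import Coquelicot.
Open Scope R_scope.

Definition halfplane (p : R * R) : Prop := 0 < fst p.

Definition connected_subset {T : UniformSpace} (S : T -> Prop) : Prop :=
  forall U V : T -> Prop,
    open U -> open V ->
    (forall x, S x -> U x \/ V x) ->
    (exists x, S x /\ U x) ->
    (exists x, S x /\ V x) ->
    exists x, S x /\ U x /\ V x.

Definition is_domain {T : UniformSpace} (S : T -> Prop) : Prop :=
  (exists x, S x) /\ open S /\ connected_subset S.

Definition accumulation_point {T : UniformSpace} (S : T -> Prop) (x : T) : Prop :=
  forall U : T -> Prop, locally x U -> exists y, U y /\ y <> x /\ S y.

(* The point r e^{i theta}, for p = (r, theta); not injective on the half-plane. *)
Definition polar (p : R * R) : C :=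
  (RtoC (fst p) * (cos (snd p), sin (snd p)))%C.

(* A function on [D] is encoded as a total function whose values outside [D]
   are never used: the limit is taken over points of [D] other than [p].
   The denominator does not vanish for [q <> p] close to [p] when [0 < fst p]. *)
Definition is_polar_derive (D : R * R -> Prop) (f : R * R -> C)
    (p : R * R) (l : C) : Prop :=
  filterlim (fun q : R * R => ((f q - f p) / (polar q - polar p))%C)
    (within D (locally' p)) (locally l).

Definition polar_analytic (D : R * R -> Prop) (f : R * R -> C) : Prop :=
  forall p, D p -> exists l : C, is_polar_derive D f p l.

(* Main.v *)
Require Import Defs.
From Stdlib Require Import Reals Lra Classical ClassicalEpsilon.
From Coquelicot Require Import Coquelicot.
Open Scope R_scope.

(* In the chart [w = log (r / r0) + i (theta - theta0)] one has
   [r e^(i theta) = r0 e^(i theta0) e^w], so a polar-analytic function becomes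
   holomorphic near [w = 0].  For a holomorphic [F], Goursat's theorem on
   rectangles, applied to [(F z - F a) / (z - a)], shows that the Cauchy integral
   of [F / (z - a)] over the boundary of a square is [F a * W a] with
   [W a <> 0], so that it has the same zeros as [F] and neither the value of [W]
   nor analyticity of [F] is needed.  Expanding [1 / (z - a)] at [a = 0], zeros
   accumulating at [0] kill all Taylor coefficients of this Cauchy integral in turn, and
   the remainder bound [O((|a| / d)^n)] makes it vanish near [0].  Connectedness
   of the domain finishes the proof. *)

(** * Continuity and complex differentiability *)

(** Stated on real and imaginary parts, with [C] read as [R * R], so that real continuity lemmas and
    componentwise Riemann integrals apply directly. *)
Definition cts (F : C -> C) (p : C) : Prop :=
  continuous (fun z : R * R => fst (F z)) p /\
  continuous (fun z : R * R => snd (F z)) p.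

(** The uniform structure of [R * R] has square balls, the modulus round ones. They are compared by
    [max(|x|, |y|) <= |x + i y| <= |x| + |y|], at the cost of halving [eps] or [d]. *)
Lemma cts_eps (F : C -> C) (p : C) :
  cts F p <->
  forall eps, 0 < eps -> exists del, 0 < del /\
    forall z, Cmod (z - p) < del -> Cmod (F z - F p) < eps.
Proof.
split.
- intros [H1 H2] eps He.
  assert (He2 : 0 < eps / 2) by lra.
  destruct (proj1 (filterlim_locally _ _) H1 (mkposreal _ He2)) as [d1 D1].
  destruct (proj1 (filterlim_locally _ _) H2 (mkposreal _ He2)) as [d2 D2].
  exists (Rmin d1 d2); split.
    apply Rmin_glb_lt; [apply d1 | apply d2].
  intros z Hz.
  assert (Hb : Rabs (fst z - fst p) < Rmin d1 d2 /\ Rabs (snd z - snd p) < Rmin d1 d2).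
  { pose proof (Rmax_Cmod (z - p)%C) as HM.
    pose proof (Rmax_l (Rabs (fst (z - p)%C)) (Rabs (snd (z - p)%C))).
    pose proof (Rmax_r (Rabs (fst (z - p)%C)) (Rabs (snd (z - p)%C))).
    split; apply Rle_lt_trans with (2 := Hz);
      eapply Rle_trans; [| exact HM | | exact HM]; assumption. }
  pose proof (Rmin_l d1 d2); pose proof (Rmin_r d1 d2).
  assert (B1 : Rabs (fst (F z) - fst (F p)) < eps / 2).
  { apply (D1 z); split; (eapply Rlt_le_trans; [apply Hb | assumption]). }
  assert (B2 : Rabs (snd (F z) - snd (F p)) < eps / 2).
  { apply (D2 z); split; (eapply Rlt_le_trans; [apply Hb | assumption]). }
  replace (F z - F p)%C with (RtoC (fst (F z) - fst (F p)) + Ci * RtoC (snd (F z) - snd (F p)))%C.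
  + eapply Rle_lt_trans; [apply Cmod_triangle|].
    rewrite Cmod_mult, Cmod_Ci, !Cmod_R; lra.
  + apply injective_projections; simpl; ring.
- intros H; split; apply filterlim_locally; intros [eps He];
  destruct (H eps He) as [d [Hd D]];
  assert (Hd2 : 0 < d / 2) by lra; exists (mkposreal _ Hd2);
  intros z [Z1 Z2]; change (Rabs (fst z - fst p) < d / 2) in Z1;
  change (Rabs (snd z - snd p) < d / 2) in Z2;
  (assert (Hz : Cmod (z - p) < d);
   [ replace (z - p)%C with (RtoC (fst z - fst p) + Ci * RtoC (snd z - snd p))%C;
     [ eapply Rle_lt_trans; [apply Cmod_triangle|];
       rewrite Cmod_mult, Cmod_Ci, !Cmod_R; lra
     | apply injective_projections; simpl; ring ] |]);
  specialize (D z Hz); pose proof (Rmax_Cmod (F z - F p)%C) as HM;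
  pose proof (Rmax_l (Rabs (fst (F z - F p)%C)) (Rabs (snd (F z - F p)%C)));
  pose proof (Rmax_r (Rabs (fst (F z - F p)%C)) (Rabs (snd (F z - F p)%C))).
  + change (Rabs (fst (F z - F p)%C) < eps); lra.
  + change (Rabs (snd (F z - F p)%C) < eps); lra.
Qed.

Lemma cts_const (c p : C) : cts (fun _ => c) p.
Proof. split; apply continuous_const. Qed.

Lemma cts_id (p : C) : cts (fun z => z) p.
Proof. destruct p; split; [apply continuous_fst | apply continuous_snd]. Qed.

Lemma cts_plus (F G : C -> C) (p : C) :
  cts F p -> cts G p -> cts (fun z => F z + G z)%C p.
Proof.
intros [F1 F2] [G1 G2]; split.
- exact (continuous_plus _ _ _ F1 G1).
- exact (continuous_plus _ _ _ F2 G2).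
Qed.

Lemma cts_mult (F G : C -> C) (p : C) :
  cts F p -> cts G p -> cts (fun z => F z * G z)%C p.
Proof.
intros [F1 F2] [G1 G2]; split.
- apply (continuous_minus (K := R_AbsRing) (V := R_NormedModule)).
  + exact (continuous_mult _ _ _ F1 G1).
  + exact (continuous_mult _ _ _ F2 G2).
- apply (continuous_plus (K := R_AbsRing) (V := R_NormedModule)).
  + exact (continuous_mult _ _ _ F1 G2).
  + exact (continuous_mult _ _ _ F2 G1).
Qed.

Lemma cts_inv (F : C -> C) (p : C) :
  cts F p -> F p <> 0%C -> cts (fun z => / F z)%C p.
Proof.
intros [F1 F2] Hn.
assert (Hp : fst (F p) ^ 2 + snd (F p) ^ 2 <> 0).
{ intros E; apply Hn; apply injective_projections; simpl; nra. }
assert (Hc : continuous (fun z : R * R => / (fst (F z) ^ 2 + snd (F z) ^ 2)) p).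
{ apply (continuous_comp (U := prod_UniformSpace R_UniformSpace R_UniformSpace)
    (fun z : R * R => fst (F z) ^ 2 + snd (F z) ^ 2) Rinv);
    [| apply continuous_Rinv; exact Hp].
  apply (continuous_plus (K := R_AbsRing) (V := R_NormedModule)).
  - apply continuous_ext with (fun z : R * R => fst (F z) * fst (F z)).
    { intros z; simpl; ring. }
    exact (continuous_mult _ _ _ F1 F1).
  - apply continuous_ext with (fun z : R * R => snd (F z) * snd (F z)).
    { intros z; simpl; ring. }
    exact (continuous_mult _ _ _ F2 F2). }
split.
- exact (continuous_mult _ _ _ F1 Hc).
- refine (continuous_mult (fun z : R * R => - snd (F z)) _ _ _ Hc).
  exact (continuous_opp _ _ F2).
Qed.

Lemma cts_ext (F G : C -> C) (p : C) :
  (forall z, F z = G z) -> cts F p -> cts G p.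
Proof.
intros E [F1 F2]; split; [eapply continuous_ext; [| exact F1] | eapply continuous_ext; [| exact F2]];
  intros z; simpl; now rewrite E.
Qed.

(* Caratheodory's form of complex differentiability. *)
Definition hol (F : C -> C) (p : C) : Prop :=
  exists psi : C -> C, cts psi p /\
    forall z, (F z - F p = psi z * (z - p))%C.

Lemma hol_cts (F : C -> C) (p : C) : hol F p -> cts F p.
Proof.
intros [psi [H E]].
apply cts_ext with (fun z => F p + psi z * (z + - p))%C.
- intros z; fold (z - p)%C; rewrite <- E; ring.
- apply cts_plus; [apply cts_const |].
  apply cts_mult; [exact H |].
  apply cts_plus; [apply cts_id | apply cts_const].
Qed.

Lemma Cminus_neq_0 (z a : C) : z <> a -> (z - a)%C <> 0%C.
Proof.
intros H E; apply H; replace z with (z - a + a)%C by ring; rewrite E; ring.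
Qed.

(* Division by zero gives [0] in Coquelicot, so that the identity below also holds at [z = a]. *)
Lemma hol_slope (F : C -> C) (a p : C) :
  p <> a -> hol F p -> hol (fun z => (F z - F a) / (z - a))%C p.
Proof.
intros Hpa [psi [H E]].
pose proof (Cminus_neq_0 _ _ Hpa) as Hn.
(* With [c = (F p - F a) / (p - a)] one has [F z - F a = psi z * (z - p) + c * (p - a)], so for
   [z <> a] the quotient differs from [c] by [(psi z - c) / (z - a) * (z - p)]. At [z = a] the
   quotient is [0], which forces the value [c / (p - a)]. *)
exists (fun z => if excluded_middle_informative (z = a)
           then ((F p - F a) / (p - a) / (p - a))%C
           else ((psi z - (F p - F a) / (p - a)) / (z - a))%C).
split.
- apply cts_eps.
  assert (Hc : cts (fun z => (psi z + - ((F p - F a) / (p - a))) * / (z + - a))%C p).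
  { apply cts_mult.
    - apply cts_plus; [exact H | apply cts_const].
    - apply cts_inv; [| exact Hn].
      apply cts_plus; [apply cts_id | apply cts_const]. }
  rewrite cts_eps in Hc.
  intros eps He; destruct (Hc eps He) as [d [Hd D]].
  exists (Rmin d (Cmod (p - a))); split.
    apply Rmin_glb_lt; [exact Hd | now apply Cmod_gt_0].
  intros z Hz.
  destruct (excluded_middle_informative (p = a)) as [|_]; [easy |].
  destruct (excluded_middle_informative (z = a)) as [Ez|_].
  + exfalso; rewrite Ez in Hz.
    replace (a - p)%C with (- (p - a))%C in Hz by ring.
    rewrite Cmod_opp in Hz.
    pose proof (Rmin_r d (Cmod (p - a))); lra.
  + apply D; pose proof (Rmin_l d (Cmod (p - a))); lra.
- intros z.
  destruct (excluded_middle_informative (z = a)) as [->|Hz].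
  + unfold Cdiv; generalize (/ (a - a))%C; intros c.
    field; exact Hn.
  + pose proof (Cminus_neq_0 _ _ Hz).
    replace (F z - F a)%C with (psi z * (z - p) + (F p - F a))%C.
    { field; now split. }
    rewrite <- E; ring.
Qed.

(** * Integrals along segments *)

Lemma cts_horizontal (F : C -> C) (x y : R) :
  cts F (x, y) ->
  continuous (fun t => fst (F (t, y))) x /\ continuous (fun t => snd (F (t, y))) x.
Proof.
intros [H1 H2]; split.
- apply (continuous_comp_2 (fun t : R => t) (fun _ : R => y) (fun s t => fst (F (s, t)))).
    apply continuous_id. apply continuous_const.
  apply continuous_ext with (2 := H1); now intros [].
- apply (continuous_comp_2 (fun t : R => t) (fun _ : R => y) (fun s t => snd (F (s, t)))).
    apply continuous_id. apply continuous_const.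
  apply continuous_ext with (2 := H2); now intros [].
Qed.

Lemma cts_vertical (F : C -> C) (x y : R) :
  cts F (x, y) ->
  continuous (fun t => fst (F (x, t))) y /\ continuous (fun t => snd (F (x, t))) y.
Proof.
intros [H1 H2]; split.
- apply (continuous_comp_2 (fun _ : R => x) (fun t : R => t) (fun s t => fst (F (s, t)))).
    apply continuous_const. apply continuous_id.
  apply continuous_ext with (2 := H1); now intros [].
- apply (continuous_comp_2 (fun _ : R => x) (fun t : R => t) (fun s t => snd (F (s, t)))).
    apply continuous_const. apply continuous_id.
  apply continuous_ext with (2 := H2); now intros [].
Qed.

Definition cint (g : R -> C) (a b : R) : C :=
  (RInt (fun t => fst (g t)) a b, RInt (fun t => snd (g t)) a b).

Definition ccont (g : R -> C) (a b : R) : Prop :=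
  forall t, a <= t <= b ->
    continuous (fun t => fst (g t)) t /\ continuous (fun t => snd (g t)) t.

Lemma ccont_ex_RInt (g : R -> C) (a b : R) :
  a <= b -> ccont g a b ->
  ex_RInt (fun t => fst (g t)) a b /\ ex_RInt (fun t => snd (g t)) a b.
Proof.
intros Hab H; split; apply (ex_RInt_continuous (V := R_CompleteNormedModule));
  rewrite (Rmin_left _ _ Hab), (Rmax_right _ _ Hab); intros z Hz; apply (H z Hz).
Qed.

Lemma cint_ext (g h : R -> C) (a b : R) :
  a <= b -> (forall t, a <= t <= b -> g t = h t) -> cint g a b = cint h a b.
Proof.
intros Hab E; unfold cint; f_equal; apply RInt_ext;
  rewrite (Rmin_left _ _ Hab), (Rmax_right _ _ Hab); intros t Ht;
  rewrite E; auto; lra.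
Qed.

Lemma cint_plus (g h : R -> C) (a b : R) :
  a <= b -> ccont g a b -> ccont h a b ->
  cint (fun t => g t + h t)%C a b = (cint g a b + cint h a b)%C.
Proof.
intros Hab Hg Hh.
destruct (ccont_ex_RInt g a b Hab Hg) as [g1 g2].
destruct (ccont_ex_RInt h a b Hab Hh) as [h1 h2].
apply injective_projections; simpl.
- exact (RInt_plus _ _ _ _ g1 h1).
- exact (RInt_plus _ _ _ _ g2 h2).
Qed.

Lemma cint_scal (c : C) (g : R -> C) (a b : R) :
  a <= b -> ccont g a b ->
  cint (fun t => c * g t)%C a b = (c * cint g a b)%C.
Proof.
intros Hab Hg.
destruct (ccont_ex_RInt g a b Hab Hg) as [g1 g2].
assert (S : forall (k : R) (u : R -> R), ex_RInt u a b ->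
  RInt (fun t => k * u t) a b = k * RInt u a b).
{ intros k u Hu; exact (RInt_scal u a b k Hu). }
assert (E : forall (k : R) (u : R -> R), ex_RInt u a b -> ex_RInt (fun t => k * u t) a b).
{ intros k u Hu; exact (ex_RInt_scal u a b k Hu). }
apply injective_projections; simpl; rewrite <- !S by assumption.
- exact (RInt_minus _ _ _ _ (E _ _ g1) (E _ _ g2)).
- exact (RInt_plus _ _ _ _ (E _ _ g2) (E _ _ g1)).
Qed.

Lemma cint_Chasles (g : R -> C) (a b c : R) :
  a <= b -> b <= c -> ccont g a c ->
  (cint g a b + cint g b c)%C = cint g a c.
Proof.
intros Hab Hbc H.
assert (H1 : ccont g a b) by (intros t Ht; apply H; lra).
assert (H2 : ccont g b c) by (intros t Ht; apply H; lra).
destruct (ccont_ex_RInt g a b Hab H1) as [g1 g2].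
destruct (ccont_ex_RInt g b c Hbc H2) as [h1 h2].
apply injective_projections; simpl.
- exact (RInt_Chasles _ _ _ _ g1 h1).
- exact (RInt_Chasles _ _ _ _ g2 h2).
Qed.

Lemma Rabs_fst_le_Cmod (z : C) : Rabs (fst z) <= Cmod z.
Proof. eapply Rle_trans; [apply Rmax_l | apply Rmax_Cmod]. Qed.

Lemma Rabs_snd_le_Cmod (z : C) : Rabs (snd z) <= Cmod z.
Proof. eapply Rle_trans; [apply Rmax_r | apply Rmax_Cmod]. Qed.

Lemma Cmod_le_Rabs (z : C) : Cmod z <= Rabs (fst z) + Rabs (snd z).
Proof.
replace z with (RtoC (fst z) + Ci * RtoC (snd z))%C at 1
  by (apply injective_projections; simpl; ring).
eapply Rle_trans; [apply Cmod_triangle |].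
rewrite Cmod_mult, Cmod_Ci, !Cmod_R; lra.
Qed.

(** The factor [2] comes from bounding the real and imaginary parts separately. *)
Lemma cint_bound (g : R -> C) (a b M : R) :
  a <= b -> ccont g a b -> (forall t, a <= t <= b -> Cmod (g t) <= M) ->
  Cmod (cint g a b) <= 2 * M * (b - a).
Proof.
intros Hab H HM.
destruct (ccont_ex_RInt g a b Hab H) as [g1 g2].
assert (B1 : Rabs (RInt (fun t => fst (g t)) a b) <= (b - a) * M).
{ apply abs_RInt_le_const; auto; intros t Ht.
  eapply Rle_trans; [apply Rabs_fst_le_Cmod | now apply HM]. }
assert (B2 : Rabs (RInt (fun t => snd (g t)) a b) <= (b - a) * M).
{ apply abs_RInt_le_const; auto; intros t Ht.
  eapply Rle_trans; [apply Rabs_snd_le_Cmod | now apply HM]. }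
eapply Rle_trans; [apply Cmod_le_Rabs |]; simpl; lra.
Qed.

(** * Boundary integrals over rectangles *)

Definition rect (x1 x2 y1 y2 : R) (p : C) : Prop :=
  x1 <= fst p <= x2 /\ y1 <= snd p <= y2.

Definition rect_bd (x1 x2 y1 y2 : R) (p : C) : Prop :=
  (x1 <= fst p <= x2 /\ (snd p = y1 \/ snd p = y2)) \/
  (y1 <= snd p <= y2 /\ (fst p = x1 \/ fst p = x2)).

Lemma rect_bd_rect (x1 x2 y1 y2 : R) (p : C) :
  x1 <= x2 -> y1 <= y2 -> rect_bd x1 x2 y1 y2 p -> rect x1 x2 y1 y2 p.
Proof. intros Hx Hy; unfold rect_bd, rect; lra. Qed.

(** The counterclockwise contour integral of [F z dz]: bottom and right sides count positively, top
    and left sides negatively, and [dz = i dy] on the vertical sides. *)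
Definition bint (F : C -> C) (x1 x2 y1 y2 : R) : C :=
  (cint (fun x => F (x, y1)) x1 x2 - cint (fun x => F (x, y2)) x1 x2 +
   Ci * (cint (fun y => F (x2, y)) y1 y2 - cint (fun y => F (x1, y)) y1 y2))%C.

Lemma ccont_edges (F : C -> C) (x1 x2 y1 y2 : R) :
  x1 <= x2 -> y1 <= y2 ->
  (forall p, rect_bd x1 x2 y1 y2 p -> cts F p) ->
  ccont (fun x => F (x, y1)) x1 x2 /\ ccont (fun x => F (x, y2)) x1 x2 /\
  ccont (fun y => F (x1, y)) y1 y2 /\ ccont (fun y => F (x2, y)) y1 y2.
Proof.
intros Hx Hy H; repeat split; intros;
  try (apply (cts_horizontal F), H; unfold rect_bd; simpl; tauto);
  apply (cts_vertical F), H; unfold rect_bd; simpl; tauto.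
Qed.

Lemma bint_ext (F G : C -> C) (x1 x2 y1 y2 : R) :
  x1 <= x2 -> y1 <= y2 ->
  (forall p, rect_bd x1 x2 y1 y2 p -> F p = G p) ->
  bint F x1 x2 y1 y2 = bint G x1 x2 y1 y2.
Proof.
intros Hx Hy E; unfold bint.
rewrite (cint_ext (fun x => F (x, y1)) (fun x => G (x, y1))),
  (cint_ext (fun x => F (x, y2)) (fun x => G (x, y2))),
  (cint_ext (fun y => F (x1, y)) (fun y => G (x1, y))),
  (cint_ext (fun y => F (x2, y)) (fun y => G (x2, y))); auto;
  intros t Ht; apply E; unfold rect_bd; simpl; tauto.
Qed.

Lemma bint_plus (F G : C -> C) (x1 x2 y1 y2 : R) :
  x1 <= x2 -> y1 <= y2 ->
  (forall p, rect_bd x1 x2 y1 y2 p -> cts F p) ->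
  (forall p, rect_bd x1 x2 y1 y2 p -> cts G p) ->
  bint (fun z => F z + G z)%C x1 x2 y1 y2 =
  (bint F x1 x2 y1 y2 + bint G x1 x2 y1 y2)%C.
Proof.
intros Hx Hy HF HG.
destruct (ccont_edges F x1 x2 y1 y2 Hx Hy HF) as (f1 & f2 & f3 & f4).
destruct (ccont_edges G x1 x2 y1 y2 Hx Hy HG) as (g1 & g2 & g3 & g4).
unfold bint; rewrite !cint_plus by assumption; ring.
Qed.

Lemma bint_scal (c : C) (F : C -> C) (x1 x2 y1 y2 : R) :
  x1 <= x2 -> y1 <= y2 ->
  (forall p, rect_bd x1 x2 y1 y2 p -> cts F p) ->
  bint (fun z => c * F z)%C x1 x2 y1 y2 = (c * bint F x1 x2 y1 y2)%C.
Proof.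
intros Hx Hy HF.
destruct (ccont_edges F x1 x2 y1 y2 Hx Hy HF) as (f1 & f2 & f3 & f4).
unfold bint; rewrite !cint_scal by assumption; ring.
Qed.

Lemma bint_bound (F : C -> C) (x1 x2 y1 y2 M : R) :
  x1 <= x2 -> y1 <= y2 ->
  (forall p, rect_bd x1 x2 y1 y2 p -> cts F p) ->
  (forall p, rect_bd x1 x2 y1 y2 p -> Cmod (F p) <= M) ->
  Cmod (bint F x1 x2 y1 y2) <= 4 * M * ((x2 - x1) + (y2 - y1)).
Proof.
intros Hx Hy HF HM.
destruct (ccont_edges F x1 x2 y1 y2 Hx Hy HF) as (f1 & f2 & f3 & f4).
unshelve epose proof (cint_bound _ _ _ M Hx f1 _) as B1;
  [intros; apply HM; unfold rect_bd; simpl; tauto |].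
unshelve epose proof (cint_bound _ _ _ M Hx f2 _) as B2;
  [intros; apply HM; unfold rect_bd; simpl; tauto |].
unshelve epose proof (cint_bound _ _ _ M Hy f3 _) as B3;
  [intros; apply HM; unfold rect_bd; simpl; tauto |].
unshelve epose proof (cint_bound _ _ _ M Hy f4 _) as B4;
  [intros; apply HM; unfold rect_bd; simpl; tauto |].
unfold bint, Cminus.
eapply Rle_trans; [apply Cmod_triangle |].
rewrite Cmod_mult, Cmod_Ci.
pose proof (Cmod_triangle (cint (fun x => F (x, y1)) x1 x2) (- cint (fun x => F (x, y2)) x1 x2)) as T1.
pose proof (Cmod_triangle (cint (fun y => F (x2, y)) y1 y2) (- cint (fun y => F (x1, y)) y1 y2)) as T2.
rewrite Cmod_opp in T1, T2; lra.
Qed.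

(** Continuity on the outer boundary splits the two horizontal sides; the integrals along the cut
    are one and the same term with opposite signs. *)
Lemma bint_cut_x (F : C -> C) (x1 m x2 y1 y2 : R) :
  x1 <= m <= x2 -> y1 <= y2 ->
  (forall p, rect_bd x1 x2 y1 y2 p -> cts F p) ->
  bint F x1 x2 y1 y2 = (bint F x1 m y1 y2 + bint F m x2 y1 y2)%C.
Proof.
intros [Hx1 Hx2] Hy HF.
destruct (ccont_edges F x1 x2 y1 y2 (Rle_trans _ _ _ Hx1 Hx2) Hy HF) as (f1 & f2 & _ & _).
unfold bint; rewrite <- (cint_Chasles _ x1 m x2 Hx1 Hx2 f1),
  <- (cint_Chasles _ x1 m x2 Hx1 Hx2 f2); ring.
Qed.

Lemma bint_cut_y (F : C -> C) (x1 x2 y1 m y2 : R) :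
  x1 <= x2 -> y1 <= m <= y2 ->
  (forall p, rect_bd x1 x2 y1 y2 p -> cts F p) ->
  bint F x1 x2 y1 y2 = (bint F x1 x2 y1 m + bint F x1 x2 m y2)%C.
Proof.
intros Hx [Hy1 Hy2] HF.
destruct (ccont_edges F x1 x2 y1 y2 Hx (Rle_trans _ _ _ Hy1 Hy2) HF) as (_ & _ & f1 & f2).
unfold bint; rewrite <- (cint_Chasles _ y1 m y2 Hy1 Hy2 f1),
  <- (cint_Chasles _ y1 m y2 Hy1 Hy2 f2); ring.
Qed.

Lemma bint_const (c : C) (x1 x2 y1 y2 : R) : bint (fun _ => c) x1 x2 y1 y2 = RtoC 0.
Proof. unfold bint; ring. Qed.

Lemma bint_id (x1 x2 y1 y2 : R) : bint (fun z => z) x1 x2 y1 y2 = RtoC 0.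
Proof.
unfold bint, cint; simpl.
rewrite !RInt_const; unfold scal; simpl; unfold mult; simpl.
apply injective_projections; simpl; ring.
Qed.

(** * Goursat's theorem *)

(** Chooses the nested rectangles of Goursat's proof. The recursion runs over elements paired with a
    proof of [Q], so that a next choice always exists. *)
Lemma dependent_choice (A : Type) (Q : nat -> A -> Prop) (T : nat -> A -> A -> Prop) (a : A) :
  Q O a ->
  (forall n x, Q n x -> exists y, Q (S n) y /\ T n x y) ->
  exists u : nat -> A, forall n, Q n (u n) /\ T n (u n) (u (S n)).
Proof.
intros H0 HS.
pose (step := fun n (x : {x | Q n x}) =>
  constructive_indefinite_description _ (HS n (proj1_sig x) (proj2_sig x))).
pose (v := fix v n : {x | Q n x} :=
  match n with
  | O => exist _ a H0
  | S k => exist _ (proj1_sig (step k (v k))) (proj1 (proj2_sig (step k (v k))))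
  end).
exists (fun n => proj1_sig (v n)); intros n; split.
- exact (proj2_sig (v n)).
- exact (proj2 (proj2_sig (step n (v n)))).
Qed.

(** The supremum of the left ends works, since every [l n] is below every [r m]: compare both at the
    index [m + n]. *)
Lemma nested_intervals (l r : nat -> R) :
  (forall n, l n <= r n) -> (forall n, l n <= l (S n)) -> (forall n, r (S n) <= r n) ->
  exists t, forall n, l n <= t <= r n.
Proof.
intros Hlr Hl Hr.
assert (Ml : forall n k, l n <= l (k + n)%nat).
{ induction k as [|k IH]; simpl; [lra | specialize (Hl (k + n)%nat); lra]. }
assert (Mr : forall n k, r (k + n)%nat <= r n).
{ induction k as [|k IH]; simpl; [lra | specialize (Hr (k + n)%nat); lra]. }
assert (X : forall n m, l n <= r m).
{ intros n m; specialize (Ml n m); specialize (Mr m n); specialize (Hlr (m + n)%nat).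
  rewrite (Nat.add_comm n m) in Mr; lra. }
destruct (completeness (fun x => exists n, x = l n)) as [t [Ht1 Ht2]].
- exists (r O); intros x [n ->]; apply X.
- now exists (l O), O.
- exists t; intros n; split.
  + apply Ht1; now exists n.
  + apply Ht2; intros x [m ->]; apply X.
Qed.

(** The integral is the sum of those over four quarters, so they cannot all have less than a fourth
    of its modulus. *)
Lemma bint_quarter (F : C -> C) (x y w h : R) :
  0 <= w -> 0 <= h ->
  (forall p, rect x (x + w) y (y + h) p -> cts F p) ->
  exists x' y', x <= x' <= x + w / 2 /\ y <= y' <= y + h / 2 /\
    Cmod (bint F x (x + w) y (y + h)) / 4 <=
    Cmod (bint F x' (x' + w / 2) y' (y' + h / 2)).
Proof.
intros Hw Hh HF.
assert (B : forall a b c d, x <= a -> a <= b -> b <= x + w -> y <= c -> c <= d -> d <= y + h ->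
  forall p, rect_bd a b c d p -> cts F p).
{ intros a b c d H1 H2 H3 H4 H5 H6 p Hp; apply HF.
  unfold rect_bd in Hp; unfold rect; lra. }
rewrite (bint_cut_x F x (x + w / 2)), (bint_cut_y F x (x + w / 2) y (y + h / 2)),
  (bint_cut_y F (x + w / 2) (x + w) y (y + h / 2));
  try lra; try (apply B; lra).
replace (x + w) with (x + w / 2 + w / 2) by lra.
replace (y + h) with (y + h / 2 + h / 2) by lra.
set (A1 := bint F x _ y _); set (A2 := bint F x _ (y + h / 2) _);
  set (A3 := bint F (x + w / 2) _ y _); set (A4 := bint F (x + w / 2) _ (y + h / 2) _).
pose proof (Cmod_triangle (A1 + A2) (A3 + A4)).
pose proof (Cmod_triangle A1 A2); pose proof (Cmod_triangle A3 A4).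
apply NNPP; intros N.
assert (N1 : Cmod A1 < Cmod (A1 + A2 + (A3 + A4)) / 4).
{ apply Rnot_le_lt; intros L; apply N; exists x, y; repeat split; try lra; exact L. }
assert (N2 : Cmod A2 < Cmod (A1 + A2 + (A3 + A4)) / 4).
{ apply Rnot_le_lt; intros L; apply N; exists x, (y + h / 2); repeat split; try lra; exact L. }
assert (N3 : Cmod A3 < Cmod (A1 + A2 + (A3 + A4)) / 4).
{ apply Rnot_le_lt; intros L; apply N; exists (x + w / 2), y; repeat split; try lra; exact L. }
assert (N4 : Cmod A4 < Cmod (A1 + A2 + (A3 + A4)) / 4).
{ apply Rnot_le_lt; intros L; apply N; exists (x + w / 2), (y + h / 2); repeat split; try lra; exact L. }
lra.
Qed.

(* Subtracting the affine approximation at [t] does not change the integral. *)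
Lemma bint_local (F : C -> C) (t : C) (eps : R) :
  hol F t -> 0 < eps -> exists del, 0 < del /\
  forall x y w h, 0 <= w -> 0 <= h -> w + h < del ->
    rect x (x + w) y (y + h) t ->
    (forall p, rect x (x + w) y (y + h) p -> cts F p) ->
    Cmod (bint F x (x + w) y (y + h)) <= eps * (w + h) ^ 2.
Proof.
intros [psi [Hc E]] He.
rewrite cts_eps in Hc.
(* On the boundary [|p - t| <= w + h], so the remainder [(psi p - psi t) * (p - t)] is at most
   [eps / 4 * (w + h)]; the [4] of [bint_bound] then cancels. *)
destruct (Hc (eps / 4)) as [d [Hd D]]; [lra |].
exists d; split; [exact Hd |].
intros x y w h Hw Hh Hwh [Ht1 Ht2] HF.
assert (HF' : forall p, rect_bd x (x + w) y (y + h) p -> cts F p).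
{ intros p Hp; apply HF, rect_bd_rect; auto; lra. }
assert (HI : forall p, rect_bd x (x + w) y (y + h) p -> cts (fun z => z) p).
{ intros p _; apply cts_id. }
assert (HL : forall p, rect_bd x (x + w) y (y + h) p -> cts (fun z => - psi t * z)%C p).
{ intros p _; apply cts_mult; [apply cts_const | apply cts_id]. }
set (G := fun z => (F z + (- F t + psi t * t + - psi t * z))%C).
assert (HA : forall p, rect_bd x (x + w) y (y + h) p ->
  cts (fun z => - F t + psi t * t + - psi t * z)%C p).
{ intros p Hp; apply cts_plus; [apply cts_const | now apply HL]. }
assert (HG : forall p, rect_bd x (x + w) y (y + h) p -> cts G p).
{ intros p Hp; apply cts_plus; auto. }
replace (bint F x (x + w) y (y + h)) with (bint G x (x + w) y (y + h)).
- eapply Rle_trans.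
  + apply (bint_bound G x (x + w) y (y + h) (eps / 4 * (w + h))); auto; try lra.
    intros p Hp; replace (G p) with ((psi p - psi t) * (p - t))%C.
    * assert (Hd' : Cmod (p - t) <= w + h).
      { eapply Rle_trans; [apply Cmod_le_Rabs |]; simpl.
        unfold rect_bd in Hp.
        apply Rplus_le_compat; apply Rabs_le; lra. }
      rewrite Cmod_mult; apply Rmult_le_compat; try apply Cmod_ge_0; auto.
      left; apply D; lra.
    * unfold G; replace (F p) with (psi p * (p - t) + F t)%C; [ring |].
      rewrite <- E; ring.
  + replace (x + w - x + (y + h - y)) with (w + h) by ring; simpl; lra.
- unfold G; rewrite bint_plus; auto; try lra.
  rewrite bint_plus; auto; try lra; [| intros; apply cts_const].
  rewrite bint_const, bint_scal, bint_id; auto; try lra; ring.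
Qed.

(** If the integral had modulus [c > 0], repeated quartering would give nested rectangles, scaled by
    [s n = 2^-n], with integrals of modulus at least [c * s n ^ 2]. Differentiability at their
    common point bounds these by [eps * (w + h) ^ 2 * s n ^ 2] for large [n]. *)
Theorem goursat (F : C -> C) (x1 x2 y1 y2 : R) :
  x1 <= x2 -> y1 <= y2 ->
  (forall p, rect x1 x2 y1 y2 p -> hol F p) ->
  bint F x1 x2 y1 y2 = RtoC 0.
Proof.
intros Hx Hy HF; apply NNPP; intros Hne.
apply Cmod_gt_0 in Hne; set (c := Cmod (bint F x1 x2 y1 y2)) in Hne.
pose (w := x2 - x1); pose (h := y2 - y1); pose (s := fun n => (/ 2) ^ n).
assert (Hs : forall n, 0 < s n) by (intros n; apply pow_lt; lra).
assert (HS : forall n, s (S n) = s n / 2) by (intros n; unfold s; simpl; lra).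
pose (Q := fun n (p : R * R) =>
  (x1 <= fst p /\ fst p + w * s n <= x2) /\ (y1 <= snd p /\ snd p + h * s n <= y2) /\
  c * s n ^ 2 <= Cmod (bint F (fst p) (fst p + w * s n) (snd p) (snd p + h * s n))).
pose (T := fun n (p q : R * R) =>
  (fst p <= fst q /\ fst q + w * s (S n) <= fst p + w * s n) /\
  (snd p <= snd q /\ snd q + h * s (S n) <= snd p + h * s n)).
assert (Hw : forall n, 0 <= w * s n).
{ intros n; apply Rmult_le_pos; [unfold w; lra | left; apply Hs]. }
assert (Hh : forall n, 0 <= h * s n).
{ intros n; apply Rmult_le_pos; [unfold h; lra | left; apply Hs]. }
assert (HC : forall p, rect x1 x2 y1 y2 p -> cts F p) by (intros; now apply hol_cts, HF).
destruct (dependent_choice _ Q T (x1, y1)) as [u Hu].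
- unfold Q; simpl; replace (x1 + w * s O) with x2 by (unfold w, s; simpl; ring).
  replace (y1 + h * s O) with y2 by (unfold h, s; simpl; ring).
  repeat split; try lra; unfold s; simpl; fold c; lra.
- intros n [x y] ((A1 & A2) & (A3 & A4) & A5); simpl in A1, A2, A3, A4, A5.
  destruct (bint_quarter F x y (w * s n) (h * s n)) as (x' & y' & B1 & B2 & B3); auto.
  { intros p [P1 P2]; apply HC; split; lra. }
  exists (x', y'); unfold Q, T; rewrite HS; simpl.
  replace (w * (s n / 2)) with (w * s n / 2) by lra.
  replace (h * (s n / 2)) with (h * s n / 2) by lra.
  repeat split; try lra; simpl in *; lra.
- destruct (nested_intervals (fun n => fst (u n)) (fun n => fst (u n) + w * s n)) as [tx Htx].
  { intros n; specialize (Hw n); lra. }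
  { intros n; apply (Hu n). }
  { intros n; apply (Hu n). }
  destruct (nested_intervals (fun n => snd (u n)) (fun n => snd (u n) + h * s n)) as [ty Hty].
  { intros n; specialize (Hh n); lra. }
  { intros n; apply (Hu n). }
  { intros n; apply (Hu n). }
  assert (Ht : rect x1 x2 y1 y2 (tx, ty)).
  { destruct (Hu O) as [((A1 & A2) & (A3 & A4) & _) _].
    specialize (Htx O); specialize (Hty O); split; simpl; lra. }
  pose (K := (w + h) ^ 2).
  assert (HK : 0 <= K) by apply pow2_ge_0.
  (* This [eps] satisfies [eps * K < c]. Adding [1] covers degenerate rectangles, where [K = 0];
     likewise in [w + h + 1] below. *)
  assert (He : 0 < c / (2 * (K + 1))) by (apply Rdiv_lt_0_compat; lra).
  destruct (bint_local F (tx, ty) _ (HF _ Ht) He) as [d [Hd D]].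
  assert (Hlim : exists n, (w + h) * s n < d).
  { assert (Hq : 0 < d / (w + h + 1)).
    { apply Rdiv_lt_0_compat; unfold w, h; lra. }
    destruct (pow_lt_1_zero (/ 2)) with (2 := Hq) as [n Hn].
    { rewrite Rabs_right; lra. }
    exists n; specialize (Hn n (le_n n)).
    change ((/ 2) ^ n) with (s n) in Hn; specialize (Hs n).
    rewrite Rabs_right in Hn by lra.
    apply Rlt_div_r in Hn; [| unfold w, h; lra]; lra. }
  destruct Hlim as [n Hn].
  destruct (Hu n) as [((A1 & A2) & (A3 & A4) & A5) _].
  assert (U : Cmod (bint F (fst (u n)) (fst (u n) + w * s n) (snd (u n)) (snd (u n) + h * s n))
     <= c / (2 * (K + 1)) * (w * s n + h * s n) ^ 2).
  { apply D; auto; try lra.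
    - split; [apply Htx | apply Hty].
    - intros p [P1 P2]; apply HC; split; lra. }
  replace ((w * s n + h * s n) ^ 2) with (K * s n ^ 2) in U by (unfold K; ring).
  assert (V : c * s n ^ 2 <= c / (2 * (K + 1)) * K * s n ^ 2) by lra.
  apply Rmult_le_reg_r in V; [| apply pow_lt, Hs].
  assert (E : c / (2 * (K + 1)) * (2 * (K + 1)) = c) by (field; lra).
  nra.
Qed.

(** * Cauchy's formula *)

(** The quotient is holomorphic away from [a] and bounded by some [M] near [a]. Goursat's theorem
    removes the four rectangles around a square of half-side [d] centred at [a], and the integral
    over that square is [O(d)]. *)
Lemma bint_slope (F : C -> C) (a : C) (x1 x2 y1 y2 : R) :
  x1 < fst a < x2 -> y1 < snd a < y2 ->
  (forall p, rect x1 x2 y1 y2 p -> hol F p) ->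
  bint (fun z => (F z - F a) / (z - a))%C x1 x2 y1 y2 = RtoC 0.
Proof.
intros Hx Hy HF; set (G := fun z => ((F z - F a) / (z - a))%C).
assert (HG : forall p, rect x1 x2 y1 y2 p -> p <> a -> hol G p).
{ intros p Hp Hpa; apply hol_slope; auto. }
assert (HB : exists M d, 0 <= M /\ 0 < d /\
  forall z, z <> a -> Cmod (z - a) < d -> Cmod (G z) <= M).
{ destruct (HF a) as [psi [Hc E]]; [split; lra |].
  rewrite cts_eps in Hc; destruct (Hc 1) as [d [Hd D]]; [lra |].
  exists (Cmod (psi a) + 1), d; split; [pose proof (Cmod_ge_0 (psi a)); lra |].
  split; [exact Hd |]; intros z Hza Hz; unfold G; rewrite E.
  pose proof (Cminus_neq_0 _ _ Hza).
  replace (psi z * (z - a) / (z - a))%C with (psi a + (psi z - psi a))%C by (field; assumption).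
  eapply Rle_trans; [apply Cmod_triangle |]; specialize (D z Hz); lra. }
destruct HB as (M & d0 & HM & Hd0 & HB).
assert (Hsmall : forall d, 0 < d -> x1 <= fst a - d -> fst a + d <= x2 ->
  y1 <= snd a - d -> snd a + d <= y2 -> 2 * d < d0 ->
  Cmod (bint G x1 x2 y1 y2) <= 16 * M * d).
{ intros d Hd A1 A2 A3 A4 A5.
  assert (HC : forall u1 u2 v1 v2, x1 <= u1 -> u1 <= u2 -> u2 <= x2 ->
    y1 <= v1 -> v1 <= v2 -> v2 <= y2 -> ~ rect_bd u1 u2 v1 v2 a ->
    forall p, rect_bd u1 u2 v1 v2 p -> cts G p).
  { intros u1 u2 v1 v2 ? ? ? ? ? ? Hn p Hp; apply hol_cts, HG.
    - unfold rect_bd in Hp; unfold rect; lra.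
    - now intros ->. }
  assert (HZ : forall u1 u2 v1 v2, x1 <= u1 -> u1 <= u2 -> u2 <= x2 ->
    y1 <= v1 -> v1 <= v2 -> v2 <= y2 -> ~ rect u1 u2 v1 v2 a ->
    bint G u1 u2 v1 v2 = RtoC 0).
  { intros u1 u2 v1 v2 ? ? ? ? ? ? Hn; apply goursat; auto.
    intros p [P1 P2]; apply HG; [split; lra |].
    intros ->; apply Hn; now split. }
  rewrite (bint_cut_x G x1 (fst a - d) x2 y1 y2), (HZ x1 (fst a - d) y1 y2);
    [| unfold rect; lra .. | apply HC; unfold rect_bd; lra].
  rewrite (bint_cut_x G (fst a - d) (fst a + d) x2 y1 y2), (HZ (fst a + d) x2 y1 y2);
    [| unfold rect; lra .. | apply HC; unfold rect_bd; lra].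
  rewrite (bint_cut_y G _ _ y1 (snd a - d) y2), (HZ _ _ y1 (snd a - d));
    [| unfold rect; lra .. | apply HC; unfold rect_bd; lra].
  rewrite (bint_cut_y G _ _ (snd a - d) (snd a + d) y2), (HZ _ _ (snd a + d) y2);
    [| unfold rect; lra .. | apply HC; unfold rect_bd; lra].
  rewrite !Cplus_0_l, !Cplus_0_r.
  (* The bound is [4 * M * (2 * d + 2 * d)]; boundary points of the square are within [d + d < d0]
     of [a]. *)
  eapply Rle_trans; [apply bint_bound with (M := M); try lra |].
  - apply HC; unfold rect_bd; lra.
  - intros p Hp; apply HB.
    + intros ->; unfold rect_bd in Hp; lra.
    + apply Rle_lt_trans with (2 := A5).
      eapply Rle_trans; [apply Cmod_le_Rabs |]; simpl.
      unfold rect_bd in Hp.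
      assert (Rabs (fst p + - fst a) <= d) by (apply Rabs_le; lra).
      assert (Rabs (snd p + - snd a) <= d) by (apply Rabs_le; lra); lra.
  - lra. }
apply NNPP; intros Hne; apply Cmod_gt_0 in Hne.
set (c := Cmod (bint G x1 x2 y1 y2)) in *.
set (m := Rmin (Rmin (fst a - x1) (x2 - fst a)) (Rmin (snd a - y1) (y2 - snd a))).
assert (Hm : 0 < m) by (unfold m; repeat apply Rmin_glb_lt; lra).
assert (Hm' : m <= fst a - x1 /\ m <= x2 - fst a /\ m <= snd a - y1 /\ m <= y2 - snd a).
{ unfold m; repeat split.
  - eapply Rle_trans; apply Rmin_l.
  - eapply Rle_trans; [apply Rmin_l | apply Rmin_r].
  - eapply Rle_trans; [apply Rmin_r | apply Rmin_l].
  - eapply Rle_trans; apply Rmin_r. }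
(* The three bounds keep the square inside the rectangle, give [2 * d < d0], and make [16 * M * d]
   less than [c]. *)
set (d := Rmin (Rmin m (d0 / 3)) (c / (32 * (M + 1)))).
assert (Hc : 0 < c / (32 * (M + 1))) by (apply Rdiv_lt_0_compat; lra).
assert (Hd : 0 < d) by (unfold d; repeat apply Rmin_glb_lt; lra).
assert (d <= m) by (unfold d; eapply Rle_trans; apply Rmin_l).
assert (d <= d0 / 3) by (unfold d; eapply Rle_trans; [apply Rmin_l | apply Rmin_r]).
assert (Hdc : d <= c / (32 * (M + 1))) by apply Rmin_r.
assert (U : c <= 16 * M * d) by (apply Hsmall; lra).
assert (E : c / (32 * (M + 1)) * (32 * (M + 1)) = c) by (field; lra).
nra.
Qed.

Lemma cts_inv_minus (a p : C) : p <> a -> cts (fun z => / (z - a))%C p.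
Proof.
intros H; apply cts_inv; [| now apply Cminus_neq_0].
apply cts_plus; [apply cts_id | apply cts_const].
Qed.

Lemma Cinv_fst_pos (z : C) : 0 < fst z -> 0 < fst (/ z)%C.
Proof. intros H; simpl; apply Rdiv_lt_0_compat; nra. Qed.

Lemma Cinv_fst_neg (z : C) : fst z < 0 -> 0 < - fst (/ z)%C.
Proof.
intros H; simpl; unfold Rdiv; rewrite <- Ropp_mult_distr_l_reverse.
apply Rdiv_lt_0_compat; nra.
Qed.

Lemma Cinv_snd_pos (z : C) : snd z < 0 -> 0 < snd (/ z)%C.
Proof. intros H; simpl; apply Rdiv_lt_0_compat; nra. Qed.

Lemma Cinv_snd_neg (z : C) : 0 < snd z -> 0 < - snd (/ z)%C.
Proof.
intros H; simpl; unfold Rdiv; rewrite <- Ropp_mult_distr_l_reverse.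
apply Rdiv_lt_0_compat; nra.
Qed.

(* On each side the imaginary part of [dz / (z - a)] is positive. *)
Lemma bint_inv_neq_0 (a : C) (x1 x2 y1 y2 : R) :
  x1 < fst a < x2 -> y1 < snd a < y2 ->
  bint (fun z => / (z - a))%C x1 x2 y1 y2 <> RtoC 0.
Proof.
intros Hx Hy E; apply (f_equal snd) in E.
assert (HC : forall p, rect_bd x1 x2 y1 y2 p -> cts (fun z => / (z - a))%C p).
{ intros p Hp; apply cts_inv_minus; intros ->; unfold rect_bd in Hp; lra. }
destruct (ccont_edges _ x1 x2 y1 y2 ltac:(lra) ltac:(lra) HC) as (f1 & f2 & f3 & f4).
unfold bint, cint in E; change (snd (RtoC 0)) with 0 in E.
(* Because of the factor [i] on the vertical sides, their real parts enter the imaginary part of the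
   integral. *)
set (I1 := RInt (fun t => snd (/ ((t, y1) - a))%C) x1 x2).
set (I2 := RInt (fun t => snd (/ ((t, y2) - a))%C) x1 x2).
set (I3 := RInt (fun t => fst (/ ((x1, t) - a))%C) y1 y2).
set (I4 := RInt (fun t => fst (/ ((x2, t) - a))%C) y1 y2).
assert (E' : I1 - I2 + (I4 - I3) = 0).
{ rewrite <- E; simpl; unfold I1, I2, I3, I4; simpl; ring. }
assert (J1 : 0 < I1).
{ apply RInt_gt_0; [lra | | intros x Xx; apply (f1 x Xx)].
  intros x Xx; apply Cinv_snd_pos; simpl; lra. }
assert (J4 : 0 < I4).
{ apply RInt_gt_0; [lra | | intros x Xx; apply (f4 x Xx)].
  intros x Xx; apply Cinv_fst_pos; simpl; lra. }
assert (J2 : 0 < - I2).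
{ unfold I2; rewrite <- (RInt_opp (V := R_CompleteNormedModule)) by
    (apply ccont_ex_RInt in f2; [apply f2 | lra]).
  apply RInt_gt_0; [lra | | intros x Xx; apply (continuous_opp (V := R_NormedModule)), (f2 x Xx)].
  intros x Xx; apply Cinv_snd_neg; simpl; lra. }
assert (J3 : 0 < - I3).
{ unfold I3; rewrite <- (RInt_opp (V := R_CompleteNormedModule)) by
    (apply ccont_ex_RInt in f3; [apply f3 | lra]).
  apply RInt_gt_0; [lra | | intros x Xx; apply (continuous_opp (V := R_NormedModule)), (f3 x Xx)].
  intros x Xx; apply Cinv_fst_neg; simpl; lra. }
lra.
Qed.

(** Split [F z / (z - a)] into the difference quotient, whose integral vanishes, and
    [F a / (z - a)]. The factor classically evaluated as [2 i pi] is left as an integral. *)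
Lemma cauchy_formula (F : C -> C) (a : C) (x1 x2 y1 y2 : R) :
  x1 < fst a < x2 -> y1 < snd a < y2 ->
  (forall p, rect x1 x2 y1 y2 p -> hol F p) ->
  bint (fun z => F z / (z - a))%C x1 x2 y1 y2 =
  (F a * bint (fun z => / (z - a)) x1 x2 y1 y2)%C.
Proof.
intros Hx Hy HF.
assert (HN : forall p, rect_bd x1 x2 y1 y2 p -> p <> a).
{ intros p Hp ->; unfold rect_bd in Hp; lra. }
rewrite <- bint_scal by (try lra; intros; now apply cts_inv_minus, HN).
transitivity (bint (fun z => (F z - F a) / (z - a) + F a * / (z - a))%C x1 x2 y1 y2).
- apply bint_ext; try lra; intros p Hp.
  field; now apply Cminus_neq_0, HN.
- rewrite bint_plus; try lra.
  + rewrite bint_slope by assumption; ring.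
  + intros p Hp; apply hol_cts, hol_slope; [now apply HN |].
    apply HF, rect_bd_rect; auto; lra.
  + intros p Hp; apply cts_mult; [apply cts_const | now apply cts_inv_minus, HN].
Qed.

(** * Taylor expansion and the identity theorem on a square *)

Lemma cts_pow (n : nat) (p : C) : cts (fun z => z ^ n)%C p.
Proof.
induction n as [|n IH]; simpl; [apply cts_const |].
apply cts_mult; [apply cts_id | exact IH].
Qed.

Lemma ccont_bounded (g : R -> C) (a b : R) :
  ccont g a b -> exists M, forall t, a <= t <= b -> Cmod (g t) <= M.
Proof.
intros H.
destruct (bounded_continuity (V := R_NormedModule) (fun t => fst (g t)) a b) as [M1 H1].
{ intros t Ht; apply (H t Ht). }
destruct (bounded_continuity (V := R_NormedModule) (fun t => snd (g t)) a b) as [M2 H2].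
{ intros t Ht; apply (H t Ht). }
exists (M1 + M2); intros t Ht; eapply Rle_trans; [apply Cmod_le_Rabs |].
specialize (H1 t Ht); specialize (H2 t Ht).
change (Rabs (fst (g t)) < M1) in H1; change (Rabs (snd (g t)) < M2) in H2; lra.
Qed.

Lemma bounded_rect_bd (F : C -> C) (x1 x2 y1 y2 : R) :
  x1 <= x2 -> y1 <= y2 ->
  (forall p, rect_bd x1 x2 y1 y2 p -> cts F p) ->
  exists M, 0 < M /\ forall p, rect_bd x1 x2 y1 y2 p -> Cmod (F p) <= M.
Proof.
intros Hx Hy HF; destruct (ccont_edges F x1 x2 y1 y2 Hx Hy HF) as (f1 & f2 & f3 & f4).
destruct (ccont_bounded _ _ _ f1) as [M1 H1]; destruct (ccont_bounded _ _ _ f2) as [M2 H2].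
destruct (ccont_bounded _ _ _ f3) as [M3 H3]; destruct (ccont_bounded _ _ _ f4) as [M4 H4].
exists (Rmax 1 (Rmax (Rmax M1 M2) (Rmax M3 M4))); split.
{ eapply Rlt_le_trans; [apply Rlt_0_1 | apply Rmax_l]. }
intros [x y] Hp; eapply Rle_trans; [| apply Rmax_r].
unfold rect_bd in Hp; simpl in Hp; destruct Hp as [[Hp [-> | ->]] | [Hp [-> | ->]]].
- eapply Rle_trans; [now apply H1 |]; eapply Rle_trans; [apply Rmax_l | apply Rmax_l].
- eapply Rle_trans; [now apply H2 |]; eapply Rle_trans; [apply Rmax_r | apply Rmax_l].
- eapply Rle_trans; [now apply H3 |]; eapply Rle_trans; [apply Rmax_l | apply Rmax_r].
- eapply Rle_trans; [now apply H4 |]; eapply Rle_trans; [apply Rmax_r | apply Rmax_r].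
Qed.

(* The remainder of the Taylor expansion of the Cauchy integral at [0] is [a ^ n] times this. *)
Definition taylor_rem (F : C -> C) (d : R) (n : nat) (a : C) : C :=
  bint (fun z => F z * / (z ^ n * (z - a)))%C (- d) d (- d) d.

Lemma square_bd_Cmod (d : R) (p : C) : rect_bd (- d) d (- d) d p -> d <= Cmod p.
Proof.
intros Hp; pose proof (Rabs_fst_le_Cmod p); pose proof (Rabs_snd_le_Cmod p).
pose proof (Rle_abs (fst p)); pose proof (Rle_abs (snd p)).
pose proof (Rle_abs (- fst p)); pose proof (Rle_abs (- snd p)).
rewrite Rabs_Ropp in *; unfold rect_bd in Hp; lra.
Qed.

Lemma square_bd_minus (d : R) (a p : C) :
  Cmod a <= d / 2 -> rect_bd (- d) d (- d) d p -> d / 2 <= Cmod (p - a).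
Proof.
intros Ha Hp; apply square_bd_Cmod in Hp.
pose proof (Cmod_triangle (p - a) a) as H.
replace (p - a + a)%C with p in H by ring; lra.
Qed.

Lemma square_bd_neq (d : R) (a p : C) :
  0 < d ->
  Cmod a <= d / 2 -> rect_bd (- d) d (- d) d p -> p <> RtoC 0 /\ (p - a)%C <> RtoC 0.
Proof.
intros Hd Ha Hp; split; apply Cmod_gt_0.
- apply square_bd_Cmod in Hp; lra.
- pose proof (square_bd_minus d a p Ha Hp); lra.
Qed.

Lemma cts_taylor_kernel (F : C -> C) (d : R) (n : nat) (a p : C) :
  0 < d -> (forall p, rect (- d) d (- d) d p -> hol F p) ->
  Cmod a <= d / 2 -> rect_bd (- d) d (- d) d p ->
  cts (fun z => F z * / (z ^ n * (z - a)))%C p.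
Proof.
intros Hd HF Ha Hp; destruct (square_bd_neq d a p Hd Ha Hp) as [H1 H2].
apply cts_mult.
- apply hol_cts, HF, rect_bd_rect; auto; lra.
- apply cts_inv.
  + apply cts_mult; [apply cts_pow |].
    apply cts_plus; [apply cts_id | apply cts_const].
  + apply Cmult_neq_0; [apply Cpow_nz |]; assumption.
Qed.

(** On the boundary, [1 / (z^n (z - a)) = 1 / z^(n+1) + a / (z^(n+1) (z - a))]. The first term is
    the kernel at [a = 0], so [taylor_rem F d n 0] is the Taylor coefficient of order [n]. *)
Lemma taylor_rem_S (F : C -> C) (d : R) (n : nat) (a : C) :
  0 < d -> (forall p, rect (- d) d (- d) d p -> hol F p) ->
  Cmod a <= d / 2 ->
  taylor_rem F d n a = (taylor_rem F d n 0 + a * taylor_rem F d (S n) a)%C.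
Proof.
intros Hd HF Ha; unfold taylor_rem.
assert (H0 : Cmod 0 <= d / 2) by (rewrite Cmod_0; lra).
rewrite <- bint_scal, <- bint_plus; try lra.
- apply bint_ext; try lra.
  intros p Hp; destruct (square_bd_neq d a p Hd Ha Hp) as [H1 H2].
  pose proof (Cpow_nz p n H1); simpl.
  replace (p - 0)%C with p by ring; field; auto.
- intros p Hp; now apply cts_taylor_kernel with d.
- intros p Hp; apply cts_mult; [apply cts_const | now apply cts_taylor_kernel with d].
- intros p Hp; now apply cts_taylor_kernel with d.
Qed.

Lemma taylor_rem_bound (F : C -> C) (d : R) :
  0 < d -> (forall p, rect (- d) d (- d) d p -> hol F p) ->
  exists K, 0 < K /\ forall n a, Cmod a <= d / 2 -> Cmod (taylor_rem F d n a) <= K / d ^ n.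
Proof.
intros Hd HF.
assert (HM : exists M, 0 < M /\ forall p, rect_bd (- d) d (- d) d p -> Cmod (F p) <= M).
{ apply bounded_rect_bd; try lra; intros p Hp.
  apply hol_cts, HF, rect_bd_rect; auto; lra. }
destruct HM as [M [HM HMb]].
(* On the boundary [|z| >= d] and [|z - a| >= d / 2], and [4 * (M / (d^n * (d / 2))) * (2 * d + 2 *
   d) = 32 * M / d^n]. *)
exists (32 * M); split; [lra |]; intros n a Ha.
assert (Hdn : 0 < d ^ n) by now apply pow_lt.
eapply Rle_trans.
- apply bint_bound with (M := M * / (d ^ n * (d / 2))); try lra.
  + intros p Hp; now apply cts_taylor_kernel with d.
  + intros p Hp; destruct (square_bd_neq d a p Hd Ha Hp) as [H1 H2].
    pose proof (Cpow_nz p n H1).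
    rewrite Cmod_mult, Cmod_inv, Cmod_mult, Cmod_pow by now apply Cmult_neq_0.
    apply Rmult_le_compat; auto using Cmod_ge_0.
    * left; apply Rinv_0_lt_compat, Rmult_lt_0_compat;
        [apply pow_lt |]; now apply Cmod_gt_0.
    * apply Rinv_le_contravar; [apply Rmult_lt_0_compat; lra |].
      apply Rmult_le_compat; try lra.
      -- apply pow_incr; split; [lra | now apply square_bd_Cmod].
      -- now apply square_bd_minus.
- right; field; lra.
Qed.

Lemma identity_square (F : C -> C) (d : R) :
  0 < d ->
  (forall p, rect (- d) d (- d) d p -> hol F p) ->
  (forall e, 0 < e -> exists a, a <> RtoC 0 /\ Cmod a < e /\ F a = RtoC 0) ->
  forall a, Cmod a <= d / 2 -> F a = RtoC 0.
Proof.
intros Hd HF Hz.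
set (W := fun a => bint (fun z => / (z - a))%C (- d) d (- d) d).
(* The remainder of order [0] is the whole Cauchy integral, which thus has the same zeros as [F]. *)
assert (HT : forall a, Cmod a <= d / 2 -> taylor_rem F d 0 a = (F a * W a)%C /\ W a <> RtoC 0).
{ intros a Ha.
  pose proof (Rabs_fst_le_Cmod a) as B1; pose proof (Rabs_snd_le_Cmod a) as B2.
  apply (fun H => Rle_trans _ _ _ H Ha), Rabs_le_between in B1.
  apply (fun H => Rle_trans _ _ _ H Ha), Rabs_le_between in B2.
  assert (A1 : - d < fst a < d) by lra.
  assert (A2 : - d < snd a < d) by lra.
  split; [| exact (bint_inv_neq_0 a _ _ _ _ A1 A2)].
  unfold W; rewrite <- cauchy_formula by assumption.
  unfold taylor_rem; apply bint_ext; [lra | lra |].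
  intros p Hp; simpl; now rewrite Cmult_1_l. }
destruct (taylor_rem_bound F d Hd HF) as [K [HK HB]].
assert (H0 : Cmod 0 <= d / 2) by (rewrite Cmod_0; lra).
(* A zero [b <> 0] of [F] gives [taylor_rem F d n 0 = - b * taylor_rem F d (S n) b], of modulus at
   most [Cmod b * (K / d ^ S n)]. Since [b] can be arbitrarily small, this coefficient vanishes; the
   radius chosen below makes the bound smaller than its supposed modulus [t]. *)
assert (HP : forall n a, Cmod a <= d / 2 -> taylor_rem F d 0 a = (a ^ n * taylor_rem F d n a)%C).
{ induction n as [|n IH]; intros a Ha; [simpl; ring |].
  rewrite IH by assumption; rewrite (taylor_rem_S F d n a Hd HF Ha) at 1.
  replace (taylor_rem F d n 0) with (RtoC 0); [simpl; ring |].
  symmetry; apply NNPP; intros Hne; apply Cmod_gt_0 in Hne.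
  set (t := Cmod (taylor_rem F d n 0)) in Hne.
  assert (Hdn : 0 < d ^ S n) by now apply pow_lt.
  assert (HQ : 0 < K / d ^ S n) by now apply Rdiv_lt_0_compat.
  destruct (Hz (Rmin (d / 2) (t / (K / d ^ S n)))) as (b & Hb0 & Hb & Fb).
  { apply Rmin_glb_lt; [lra | now apply Rdiv_lt_0_compat]. }
  assert (Hbd : Cmod b <= d / 2) by (left; eapply Rlt_le_trans; [exact Hb | apply Rmin_l]).
  assert (Hbt : Cmod b < t / (K / d ^ S n)) by (eapply Rlt_le_trans; [exact Hb | apply Rmin_r]).
  assert (Tb : taylor_rem F d n b = RtoC 0).
  { assert (E : (b ^ n * taylor_rem F d n b)%C = RtoC 0).
    { rewrite <- IH by assumption; rewrite (proj1 (HT b Hbd)), Fb; ring. }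
    apply NNPP; intros N; revert E; apply Cmult_neq_0; [now apply Cpow_nz | exact N]. }
  rewrite (taylor_rem_S F d n b Hd HF Hbd) in Tb.
  assert (Et : t = Cmod b * Cmod (taylor_rem F d (S n) b)).
  { rewrite <- Cmod_mult; unfold t.
    replace (taylor_rem F d n 0) with (- (b * taylor_rem F d (S n) b))%C; [apply Cmod_opp |].
    replace (taylor_rem F d n 0) with
      (taylor_rem F d n 0 + b * taylor_rem F d (S n) b - b * taylor_rem F d (S n) b)%C by ring.
    rewrite Tb; ring. }
  apply Rlt_div_r in Hbt; [| exact HQ].
  specialize (HB (S n) b Hbd); pose proof (Cmod_ge_0 b); nra. }
intros a Ha; destruct (HT a Ha) as [Ea Wa].
apply NNPP; intros N; pose proof (Cmult_neq_0 _ _ N Wa) as M.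
rewrite <- Ea in M; apply Cmod_gt_0 in M.
set (t := Cmod (taylor_rem F d 0 a)) in M.
(* By [HP], [t <= (d / 2)^n * (K / d^n) = K / 2^n] for every [n]; it remains to take [n] with
   [2^-n < t / K]. *)
assert (Hq : 0 < t / K) by now apply Rdiv_lt_0_compat.
destruct (pow_lt_1_zero (/ 2)) with (2 := Hq) as [n Hn].
{ rewrite Rabs_right; lra. }
specialize (Hn n (le_n n)).
assert (Hp : 0 < (/ 2) ^ n) by (apply pow_lt; lra).
rewrite Rabs_right in Hn by lra.
apply Rlt_div_r in Hn; [| exact HK].
assert (Hdn : 0 < d ^ n) by now apply pow_lt.
assert (U : t <= (d / 2) ^ n * (K / d ^ n)).
{ unfold t; rewrite (HP n a Ha), Cmod_mult, Cmod_pow.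
  apply Rmult_le_compat; auto using Cmod_ge_0.
  - apply pow_le, Cmod_ge_0.
  - apply pow_incr; split; [apply Cmod_ge_0 | exact Ha]. }
unfold Rdiv in U at 1; rewrite Rpow_mult_distr in U.
replace (d ^ n * (/ 2) ^ n * (K / d ^ n)) with ((/ 2) ^ n * K) in U by (field; lra).
lra.
Qed.

(** * Difference quotients and the complex exponential *)

Lemma cts_ext_loc (F G : C -> C) (p : C) (d : R) :
  0 < d -> (forall z, Cmod (z - p) < d -> F z = G z) -> cts F p -> cts G p.
Proof.
intros Hd E H; apply cts_eps; intros eps He.
rewrite cts_eps in H; destruct (H eps He) as [e [He' D]].
exists (Rmin d e); split; [now apply Rmin_glb_lt |].
intros z Hz; rewrite <- !E; [apply D | |].
- eapply Rlt_le_trans; [exact Hz | apply Rmin_r].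
- replace (p - p)%C with (RtoC 0) by ring; rewrite Cmod_0; exact Hd.
- eapply Rlt_le_trans; [exact Hz | apply Rmin_l].
Qed.

(** The candidate for [psi] in [hol]: its continuity at [p] says that [F] has derivative [l]
    there. *)
Definition slope (F : C -> C) (p l z : C) : C :=
  if excluded_middle_informative (z = p) then l else ((F z - F p) / (z - p))%C.

Lemma slope_eq (F : C -> C) (p l z : C) :
  (F z - F p = slope F p l z * (z - p))%C.
Proof.
unfold slope; destruct (excluded_middle_informative (z = p)) as [->|H]; [ring |].
field; now apply Cminus_neq_0.
Qed.

Lemma slope_at (F : C -> C) (p l : C) : slope F p l p = l.
Proof. unfold slope; now destruct (excluded_middle_informative (p = p)). Qed.

Lemma cts_slope (F : C -> C) (p l : C) :
  (forall eps, 0 < eps -> exists del, 0 < del /\ forall z, Cmod (z - p) < del ->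
    Cmod (F z - F p - l * (z - p)) <= eps * Cmod (z - p)) ->
  cts (slope F p l) p.
Proof.
intros H; apply cts_eps; intros eps He.
destruct (H (eps / 2)) as [d [Hd D]]; [lra |].
exists d; split; [exact Hd |]; intros z Hz; rewrite slope_at.
unfold slope; destruct (excluded_middle_informative (z = p)) as [->|Hn].
- replace (l - l)%C with (RtoC 0) by ring; now rewrite Cmod_0.
- pose proof (Cminus_neq_0 _ _ Hn) as Hn'.
  replace ((F z - F p) / (z - p) - l)%C with ((F z - F p - l * (z - p)) / (z - p))%C
    by (field; assumption).
  rewrite Cmod_div by assumption; apply Cmod_gt_0 in Hn'.
  apply Rlt_div_l; [exact Hn' |]; specialize (D z Hz); nra.
Qed.

Lemma derivable_pt_lim_le (u : R -> R) (l eps : R) :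
  derivable_pt_lim u 0 l -> 0 < eps ->
  exists del, 0 < del /\ forall h, Rabs h < del -> Rabs (u h - u 0 - l * h) <= eps * Rabs h.
Proof.
intros H He; destruct (H eps He) as [[d Hd] D]; exists d; split; [exact Hd |].
intros h Hh; destruct (Req_dec h 0) as [->|Hn].
- replace (u 0 - u 0 - l * 0) with 0 by ring; rewrite Rabs_R0; lra.
- specialize (D h Hn Hh); rewrite Rplus_0_l in D.
  replace (u h - u 0 - l * h) with (((u h - u 0) / h - l) * h) by (field; exact Hn).
  rewrite Rabs_mult; apply Rmult_le_compat_r; [apply Rabs_pos | lra].
Qed.

Definition cexp (z : C) : C := (exp (fst z) * cos (snd z), exp (fst z) * sin (snd z)).

Lemma cexp_plus (z w : C) : cexp (z + w) = (cexp z * cexp w)%C.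
Proof.
unfold cexp; apply injective_projections; simpl;
  rewrite exp_plus, ?cos_plus, ?sin_plus; ring.
Qed.

Lemma cexp_0 : cexp 0 = RtoC 1.
Proof.
unfold cexp; simpl; rewrite exp_0, cos_0, sin_0.
apply injective_projections; simpl; ring.
Qed.

Lemma cexp_neq_0 (z : C) : cexp z <> RtoC 0.
Proof.
intros E; assert (H : (cexp z * cexp (- z))%C = RtoC 1).
{ rewrite <- cexp_plus, <- cexp_0; f_equal; ring. }
rewrite E, Cmult_0_l in H; injection H; lra.
Qed.

(** Write [exp h = 1 + h + A], [cos k = 1 + B] and [sin k = k + S] for [z = h + i k], with [A], [B],
    [S] at most [e * |z|], and expand the product. *)
Lemma cexp_estimate_0 (eps : R) :
  0 < eps -> exists del, 0 < del /\
  forall z, Cmod z < del -> Cmod (cexp z - 1 - z) <= eps * Cmod z.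
Proof.
(* The four error terms contribute [1 + 3 + 3 + 2 = 9] times [e * m]. The bounds [m < e <= 1] give
   [|1 + h + A| <= 3] and make the quadratic term [(h + A) * k] at most [2 * m * e]. *)
intros He; set (e := Rmin 1 (eps / 9)).
assert (e0 : 0 < e) by (apply Rmin_glb_lt; lra).
assert (e1 : e <= 1) by apply Rmin_l.
assert (e2 : e <= eps / 9) by apply Rmin_r.
destruct (derivable_pt_lim_le exp _ e (derivable_pt_lim_exp 0) e0) as (d1 & Hd1 & D1).
destruct (derivable_pt_lim_le cos _ e (derivable_pt_lim_cos 0) e0) as (d2 & Hd2 & D2).
destruct (derivable_pt_lim_le sin _ e (derivable_pt_lim_sin 0) e0) as (d3 & Hd3 & D3).
exists (Rmin e (Rmin d1 (Rmin d2 d3))); split.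
{ repeat (apply Rmin_glb_lt; [assumption |]); assumption. }
intros z Hz.
pose proof (Rmin_l e (Rmin d1 (Rmin d2 d3))); pose proof (Rmin_r e (Rmin d1 (Rmin d2 d3))).
pose proof (Rmin_l d1 (Rmin d2 d3)); pose proof (Rmin_r d1 (Rmin d2 d3)).
pose proof (Rmin_l d2 d3); pose proof (Rmin_r d2 d3).
pose proof (Rabs_fst_le_Cmod z) as Hh; pose proof (Rabs_snd_le_Cmod z) as Hk.
set (m := Cmod z) in *; set (h := fst z) in *; set (k := snd z) in *.
specialize (D1 h); specialize (D2 k); specialize (D3 k).
rewrite exp_0 in D1; rewrite sin_0, cos_0 in *.
set (A := exp h - 1 - 1 * h) in D1; set (B := cos k - 1 - - 0 * k) in D2.
set (S := sin k - 0 - 1 * k) in D3.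
assert (LA : Rabs A <= e * m) by (assert (Rabs A <= e * Rabs h) by (apply D1; lra); nra).
assert (LB : Rabs B <= e * m) by (assert (Rabs B <= e * Rabs k) by (apply D2; lra); nra).
assert (LS : Rabs S <= e * m) by (assert (Rabs S <= e * Rabs k) by (apply D3; lra); nra).
assert (Lm : 0 <= m) by apply Cmod_ge_0.
assert (LhA : Rabs (h + A) <= 2 * m).
{ eapply Rle_trans; [apply Rabs_triang |]; nra. }
assert (L1 : Rabs (1 + (h + A)) <= 3).
{ eapply Rle_trans; [apply Rabs_triang |]; rewrite Rabs_R1; lra. }
eapply Rle_trans; [apply Cmod_le_Rabs |].
replace (fst (cexp z - 1 - z)%C) with (A + (1 + (h + A)) * B)
  by (unfold cexp, A, B, h, k; simpl; ring).
replace (snd (cexp z - 1 - z)%C) with ((1 + (h + A)) * S + (h + A) * k)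
  by (unfold cexp, A, S, h, k; simpl; ring).
assert (P1 : Rabs ((1 + (h + A)) * B) <= 3 * (e * m)).
{ rewrite Rabs_mult; apply Rmult_le_compat; auto using Rabs_pos. }
assert (P2 : Rabs ((1 + (h + A)) * S) <= 3 * (e * m)).
{ rewrite Rabs_mult; apply Rmult_le_compat; auto using Rabs_pos. }
assert (P3 : Rabs ((h + A) * k) <= 2 * m * e).
{ rewrite Rabs_mult; apply Rmult_le_compat; auto using Rabs_pos; lra. }
pose proof (Rabs_triang A ((1 + (h + A)) * B)).
pose proof (Rabs_triang ((1 + (h + A)) * S) ((h + A) * k)).
assert (9 * (e * m) <= eps * m) by nra.
lra.
Qed.

Lemma cts_slope_cexp (p : C) : cts (slope cexp p (cexp p)) p.
Proof.
apply cts_slope; intros eps He.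
pose proof (proj1 (Cmod_gt_0 _) (cexp_neq_0 p)) as Hp.
destruct (cexp_estimate_0 (eps / Cmod (cexp p))) as [d [Hd D]].
{ now apply Rdiv_lt_0_compat. }
exists d; split; [exact Hd |]; intros z Hz; specialize (D _ Hz).
replace (cexp z) with (cexp p * cexp (z - p))%C.
- replace (cexp p * cexp (z - p) - cexp p - cexp p * (z - p))%C
    with (cexp p * (cexp (z - p) - 1 - (z - p)))%C by ring.
  rewrite Cmod_mult.
  replace (eps * Cmod (z - p)) with (Cmod (cexp p) * (eps / Cmod (cexp p) * Cmod (z - p)))
    by (field; lra).
  apply Rmult_le_compat_l; lra.
- rewrite <- cexp_plus; f_equal; ring.
Qed.

Lemma locally_Cmod (l : C) (eps : R) :
  0 < eps -> locally l (fun y : C => Cmod (y - l) < eps).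
Proof.
intros He; assert (He2 : 0 < eps / 2) by lra.
exists (mkposreal _ He2); intros y [Y1 Y2].
change (Rabs (fst y - fst l) < eps / 2) in Y1.
change (Rabs (snd y - snd l) < eps / 2) in Y2.
eapply Rle_lt_trans; [apply Cmod_le_Rabs |].
change (fst (y - l)%C) with (fst y - fst l); change (snd (y - l)%C) with (snd y - snd l); lra.
Qed.

Lemma cts_locally (F : C -> C) (p : C) (U : R * R -> Prop) :
  cts F p -> locally (F p : R * R) U ->
  exists d, 0 < d /\ forall z, Cmod (z - p) < d -> U (F z).
Proof.
intros H [[e He] HU]; rewrite cts_eps in H.
destruct (H e He) as [d [Hd D]]; exists d; split; [exact Hd |].
intros z Hz; apply HU; specialize (D z Hz).
split; (eapply Rle_lt_trans; [| exact D]).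
- exact (Rabs_fst_le_Cmod (F z - F p)).
- exact (Rabs_snd_le_Cmod (F z - F p)).
Qed.

(** * The logarithmic chart *)

Definition chart_inv (p0 : R * R) (w : C) : C :=
  (fst p0 * exp (fst w), snd p0 + snd w).

(** The logarithm is taken from the coordinates [r] and [theta], not from [polar q], so that no
    branch is chosen and no periodicity in [theta] enters. *)
Definition chart (p0 q : R * R) : C :=
  (ln (fst q / fst p0), snd q - snd p0).

Lemma chartK (p0 q : R * R) :
  halfplane p0 -> halfplane q -> chart_inv p0 (chart p0 q) = q.
Proof.
unfold halfplane; intros H0 H; apply injective_projections; simpl; [| ring].
rewrite exp_ln by now apply Rdiv_lt_0_compat.
field; lra.
Qed.

Lemma chart_inv_0 (p0 : R * R) : chart_inv p0 0 = p0.
Proof.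
apply injective_projections; simpl; rewrite ?exp_0; ring.
Qed.

(** Turns the denominators of polar difference quotients into differences of [cexp]. *)
Lemma polar_chart_inv (p0 : R * R) (w : C) :
  polar (chart_inv p0 w) = (polar p0 * cexp w)%C.
Proof.
unfold polar, cexp, chart_inv; apply injective_projections; simpl;
  rewrite cos_plus, sin_plus; ring.
Qed.

Lemma polar_neq_0 (p : R * R) : halfplane p -> polar p <> RtoC 0.
Proof.
intros H; replace (polar p) with (RtoC (fst p) * cexp (RtoC 0 + Ci * RtoC (snd p)))%C.
- apply Cmult_neq_0; [| apply cexp_neq_0].
  intros E; injection E; unfold halfplane in H; lra.
- unfold polar, cexp; simpl.
  replace (0 + (0 * snd p - 1 * 0)) with 0 by ring.
  replace (0 + (0 * 0 + 1 * snd p)) with (snd p) by ring.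
  rewrite exp_0; apply injective_projections; simpl; ring.
Qed.

Lemma cts_chart_inv (p0 : R * R) (w : C) : cts (chart_inv p0) w.
Proof.
destruct (cts_id w) as [H1 H2]; split; simpl.
- refine (continuous_mult (fun _ => fst p0) (fun z : R * R => exp (fst z)) _ _ _).
  + apply continuous_const.
  + apply (continuous_comp (U := prod_UniformSpace R_UniformSpace R_UniformSpace)
      (fun z : R * R => fst z) exp); [exact H1 | apply continuous_exp].
- refine (continuous_plus (fun _ => snd p0) (fun z : R * R => snd z) _ _ H2).
  apply continuous_const.
Qed.

Lemma locally_chart (p0 : R * R) (e : R) :
  halfplane p0 -> 0 < e ->
  locally p0 (fun q => halfplane q /\ Cmod (chart p0 q) < e).
Proof.
unfold halfplane; intros H0 He.
assert (C1 : continuous (fun r => ln (r / fst p0)) (fst p0)).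
{ apply (continuous_comp (fun r => r / fst p0) ln).
  - refine (continuous_mult (fun r => r) (fun _ => / fst p0) _ _ _).
    + apply continuous_id.
    + apply continuous_const.
  - apply continuity_pt_filterlim.
    apply derivable_continuous_pt; exists (/ (fst p0 / fst p0)).
    apply derivable_pt_lim_ln, Rdiv_lt_0_compat; exact H0. }
assert (He2 : 0 < e / 2) by lra.
destruct (proj1 (filterlim_locally _ _) C1 (mkposreal _ He2)) as [[d Hd] D].
(* Radius [fst p0] keeps [fst q] positive; [d] and [e / 2] control the two components of the
   chart. *)
assert (Hm : 0 < Rmin (fst p0) (Rmin d (e / 2))) by (repeat apply Rmin_glb_lt; lra).
pose proof (Rmin_l (fst p0) (Rmin d (e / 2))); pose proof (Rmin_r (fst p0) (Rmin d (e / 2))).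
pose proof (Rmin_l d (e / 2)); pose proof (Rmin_r d (e / 2)).
exists (mkposreal _ Hm); intros q [Q1 Q2].
change (Rabs (fst q - fst p0) < Rmin (fst p0) (Rmin d (e / 2))) in Q1.
change (Rabs (snd q - snd p0) < Rmin (fst p0) (Rmin d (e / 2))) in Q2.
split.
- change (0 < fst q); apply Rabs_lt_between in Q1; lra.
- assert (B : Rabs (ln (fst q / fst p0) - ln (fst p0 / fst p0)) < e / 2).
  { apply D; change (Rabs (fst q - fst p0) < d); lra. }
  replace (fst p0 / fst p0) with 1 in B by (field; lra); rewrite ln_1 in B.
  eapply Rle_lt_trans; [apply Cmod_le_Rabs |].
  rewrite Rminus_0_r in B.
  change (Rabs (ln (fst q / fst p0)) + Rabs (snd q - snd p0) < e); lra.
Qed.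

(** Chain rule: with [P] the map [polar] in the chart, the slope of [g] is the quotient of
    [g w - g p] by [P w - P p], tending to [l], times the slope [sP] of [P], whose limit
    [polar p0 * cexp p] is nonzero. *)
Lemma hol_chart (D : R * R -> Prop) (f : R * R -> C) (p0 : R * R) (p : C) (l : C) :
  open D -> halfplane p0 -> D (chart_inv p0 p) ->
  is_polar_derive D f (chart_inv p0 p) l ->
  hol (fun w => f (chart_inv p0 w)) p.
Proof.
intros oD H0 Dp Hl.
set (g := fun w => f (chart_inv p0 w)).
set (P := fun w => polar (chart_inv p0 w)).
set (sP := fun w => (polar p0 * slope cexp p (cexp p) w)%C).
assert (EP : forall w, (P w - P p = sP w * (w - p))%C).
{ intros w; unfold P, sP; rewrite !polar_chart_inv.
  rewrite <- Cmult_assoc, <- slope_eq; ring. }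
assert (CP : cts sP p) by (apply cts_mult; [apply cts_const | apply cts_slope_cexp]).
assert (NP : sP p <> RtoC 0).
{ unfold sP; rewrite slope_at; apply Cmult_neq_0; [now apply polar_neq_0 | apply cexp_neq_0]. }
apply Cmod_gt_0 in NP.
destruct (proj1 (cts_eps _ _) CP _ NP) as [d [Hd HdP]].
(* Within [d], [sP w] is closer to [sP p] than [0] is, so it does not vanish and [P w] differs from
   [P p]. *)
assert (NPw : forall w, Cmod (w - p) < d -> w <> p -> (P w - P p)%C <> RtoC 0).
{ intros w Hw Hn; rewrite EP; apply Cmult_neq_0; [| now apply Cminus_neq_0].
  intros E; specialize (HdP w Hw); rewrite E in HdP.
  replace (0 - sP p)%C with (- sP p)%C in HdP by ring.
  rewrite Cmod_opp in HdP; lra. }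
set (Q := fun w => if excluded_middle_informative (w = p) then l
                   else ((g w - g p) / (P w - P p))%C).
assert (CQ : cts Q p).
{ apply cts_eps; intros eps He.
  assert (HU := Hl _ (locally_Cmod l eps He)).
  destruct (cts_locally _ p _ (cts_chart_inv p0 p) HU) as [e [He' HE]].
  destruct (cts_locally _ p _ (cts_chart_inv p0 p) (oD _ Dp)) as [e' [He'' HE']].
  exists (Rmin d (Rmin e e')); split; [repeat apply Rmin_glb_lt; assumption |].
  intros w Hw.
  pose proof (Rmin_l d (Rmin e e')); pose proof (Rmin_r d (Rmin e e')).
  pose proof (Rmin_l e e'); pose proof (Rmin_r e e').
  unfold Q; destruct (excluded_middle_informative (p = p)) as [_|]; [| easy].
  destruct (excluded_middle_informative (w = p)) as [_|Hn].
  - replace (l - l)%C with (RtoC 0) by ring; now rewrite Cmod_0.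
  - apply HE; [lra | | apply HE'; lra].
    (* The polar limit is over a punctured neighbourhood, so [w <> p] must give distinct points in
       the half-plane. *)
    intros E; apply (NPw w); [lra | exact Hn |].
    unfold P; rewrite E; ring. }
exists (slope g p (l * sP p)); split; [| apply slope_eq].
(* The factorisation is local: farther away [P w = P p] can occur with [w <> p], as [cexp] is
   periodic. *)
apply cts_ext_loc with (F := fun w => (Q w * sP w)%C) (d := d); [exact Hd | | now apply cts_mult].
intros w Hw; unfold Q, slope.
destruct (excluded_middle_informative (w = p)) as [->|Hn]; [reflexivity |].
pose proof (NPw w Hw Hn); pose proof (Cminus_neq_0 _ _ Hn).
replace (sP w) with ((P w - P p) / (w - p))%C by (rewrite EP; field; assumption).
field; now split.
Qed.

(** * Accumulating zeros and connectedness *)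

(** The chart carries zeros accumulating at [p0] to nonzero zeros accumulating at [0], where
    [identity_square] applies; [locally_chart] brings the conclusion back. *)
Lemma polar_zeros_locally (D : R * R -> Prop) (f : R * R -> C) (p0 : R * R) :
  open D -> (forall p, D p -> halfplane p) -> polar_analytic D f -> D p0 ->
  accumulation_point (fun q : R * R => D q /\ f q = RtoC 0) p0 ->
  locally p0 (fun q => f q = RtoC 0).
Proof.
intros oD DH fD Dp0 acc; pose proof (DH _ Dp0) as H0.
destruct (cts_locally (chart_inv p0) 0 D (cts_chart_inv p0 0)) as [d [Hd HD]].
{ rewrite chart_inv_0; now apply oD. }
(* Points of the square of half-side [e] have modulus at most [2 * e < d], so the chart sends the
   square into [D]. *)
set (e := d / 3); assert (He : 0 < e) by (unfold e; lra).
assert (Z : forall a, Cmod a <= e / 2 -> f (chart_inv p0 a) = RtoC 0).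
{ apply (identity_square (fun w => f (chart_inv p0 w))); [exact He | |].
  - intros p [P1 P2].
    assert (Dp : D (chart_inv p0 p)).
    { apply HD; eapply Rle_lt_trans; [apply Cmod_le_Rabs |].
      replace (p - 0)%C with p by ring.
      apply Rle_lt_trans with (e + e); [| unfold e; lra].
      apply Rplus_le_compat; apply Rabs_le; assumption. }
    destruct (fD _ Dp) as [l Hl]; now apply hol_chart with D l.
  - intros r Hr.
    destruct (acc _ (locally_chart p0 r H0 Hr)) as (q & [Hq Cq] & Hn & [Dq fq]).
    exists (chart p0 q); split; [| split; [exact Cq |]].
    + intros E; apply Hn; rewrite <- (chartK p0 q H0 Hq), E; apply chart_inv_0.
    + now rewrite chartK. }
assert (He2 : 0 < e / 2) by lra.
generalize (locally_chart p0 (e / 2) H0 He2); apply filter_imp.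
intros q [Hq Cq]; rewrite <- (chartK p0 q H0 Hq); apply Z; lra.
Qed.

Lemma locally_neq (x y : R * R) : x <> y -> locally x (fun z => z <> y).
Proof.
intros H; apply Cminus_neq_0, Cmod_gt_0 in H.
apply filter_imp with (2 := locally_Cmod x _ H); intros z Hz ->.
replace (y - x)%C with (- (x - y))%C in Hz by ring.
rewrite Cmod_opp in Hz; lra.
Qed.

Lemma locally_other_point (x : R * R) (U : R * R -> Prop) :
  locally x U -> exists y, U y /\ y <> x.
Proof.
intros [[e He] HU]; exists (fst x + e / 2, snd x); split.
- apply HU; split.
  + change (Rabs (fst x + e / 2 - fst x) < e); rewrite Rabs_right; lra.
  + apply ball_center.
- intros E; apply (f_equal fst) in E; simpl in E; lra.
Qed.

(* Points of [D] near which [f] vanishes and points of [D] at which zeros do not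
   accumulate form two disjoint open sets covering [D]. *)
Theorem theorem3 (D : R * R -> Prop) (f : R * R -> C) (p0 : R * R)
    (domD : is_domain D)
    (DH : forall p, D p -> halfplane p)
    (fD : polar_analytic D f)
    (Dp0 : D p0)
    (acc : accumulation_point (fun q : R * R => D q /\ f q = RtoC 0) p0) :
  forall p, D p -> f p = RtoC 0.
Proof.
destruct domD as [_ [oD cD]].
set (Z := fun p : R * R => locally p (fun q => f q = RtoC 0)).
set (V := fun p : R * R => locally p (fun q => q <> p -> D q -> f q <> RtoC 0)).
intros p Dp; apply NNPP; intros Hf.
assert (VZ : forall q, D q -> Z q \/ V q).
{ intros q Dq; destruct (classic (V q)) as [|N]; [now right | left].
  apply polar_zeros_locally with D; auto.
  intros U HU; apply NNPP; intros N'; apply N.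
  unfold V; apply filter_imp with (2 := HU).
  intros y Uy Hy Dy fy; apply N'; now exists y. }
destruct (cD Z V) as (x & Dx & Zx & Vx); auto.
- intros x Zx; exact (locally_locally _ _ Zx).
- intros x Vx; pose proof (locally_locally _ _ Vx) as LV.
  apply filter_imp with (2 := LV); intros y Ly.
  destruct (classic (y = x)) as [->|Hyx]; [exact Vx |].
  (* For [y <> x], a neighbourhood of [y] avoiding [x] contains no zero in [D] at all. *)
  unfold V; generalize (filter_and _ _ Ly (locally_neq y x Hyx)); apply filter_imp.
  intros z [H1 H2] _; now apply H1.
- exists p0; split; [exact Dp0 |]; now apply polar_zeros_locally with D.
- exists p; split; [exact Dp |].
  destruct (VZ p Dp) as [Zp | Vp]; [| exact Vp].
  exfalso; apply Hf; exact (locally_singleton _ _ Zp).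
(* At a common point [x], some nearby [y <> x] in [D] would be both a zero and a non-zero of [f]. *)
- pose proof (filter_and _ _ (oD x Dx) (filter_and _ _ Zx Vx)) as L.
  destruct (locally_other_point _ _ L) as (y & (Dy & fy & Hy) & Hn).
  exact (Hy Hn Dy fy).
Qed.
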